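(* There exists a Hausdorff locally convex-solid (real) vector lattice $X$ that has the $\sigma$-Lebesgue property and whose topological completion $\hat X$ does not have the $\sigma$-Lebesgue property.
   Context: All vector lattices are real; $X_+$ denotes the positive cone. A locally solid vector lattice is a vector lattice with a linear topology having a base of neighborhoods of zero consisting of solid sets ($U$ is solid if $|x|\le |y|$, $y\in U$ imply $x\in U$); it is locally convex-solid if its topology is in addition locally convex (equivalently, it is generated by a family of lattice seminorms, i.e. seminorms $p$ with $|x|\le|y|\Rightarrow p(x)\le p(y)$). A locally solid vector lattice $X$ has the $\sigma$-Lebesgue property if for every sequence $(x_n)\subseteq X_+$, $x_n\downarrow 0$ (that is, $(x_n)$ is decreasing with infimum $0$ in $X$) implies that $x_n\to 0$ in the topology of $X$. Topological completion: for a Hausdorff locally solid vector lattice $X$, its topological completion is the pair $(\hat X, J)$, unique up to isomorphism, where $\hat X$ is a complete (every Cauchy net converges) Hausdorff topological vector space and $J\colon X\to\hat X$ is a linear topological embedding with dense range; $\hat X$ is ordered by taking as positive cone the closure of $J(X_+)$, which makes $\hat X$ a Hausdorff locally solid vector lattice and $J$ a lattice homomorphism. *)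

(* Defs.v *)
From HB Require Import structures.
From mathcomp Require Import all_boot all_order all_algebra.
From mathcomp Require Import all_classical all_reals all_analysis.

Set Implicit Arguments.
Unset Strict Implicit.
Unset Printing Implicit Defensive.

Import Order.TTheory GRing.Theory Num.Theory.
Import numFieldNormedType.Exports.

Local Open Scope classical_set_scope.
Local Open Scope ring_scope.

(* HB refuses a join of [Order.Lattice] and [GRing.Zmodule] declared after
   [Num.RealDomain], so the lattice operations are part of the mixin. *)
HB.mixin Record POrderedLmodule_isVectorLattice (R : numDomainType) E
    & Num.POrderedZmodule E & GRing.Lmodule R E := {
  vlerD2r : forall z x y : E, x <= y -> x + z <= y + z ;
  vlerZ2l : forall (a : R) (x y : E), 0 <= a -> x <= y -> a *: x <= a *: y ;
  vjoin : E -> E -> E ;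
  vmeet : E -> E -> E ;
  vjoinP : forall x y z : E, (vjoin x y <= z) = (x <= z) && (y <= z) ;
  vmeetP : forall x y z : E, (z <= vmeet x y) = (z <= x) && (z <= y)
}.

#[short(type="vectorLatticeType")]
HB.structure Definition VectorLattice (R : numDomainType) :=
  {E of POrderedLmodule_isVectorLattice R E & Num.POrderedZmodule E
      & GRing.Lmodule R E}.

Section VectorLatticeDefs.
Context {R : numDomainType} {E : vectorLatticeType R}.

Definition vabs (x : E) : E := vjoin x (- x).

Definition solid (U : set E) : Prop :=
  forall x y : E, vabs x <= vabs y -> U y -> U x.

Definition poscone : set E := [set x | 0 <= x].

End VectorLatticeDefs.

Arguments poscone {R} E.

HB.mixin Record TopologicalLmodule_isLocallySolid (R : numDomainType) E
    & VectorLattice R E & TopologicalLmodule R E := {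
  locally_solid : forall U : set E, nbhs (0 : E) U ->
    exists V : set E, [/\ nbhs (0 : E) V, solid V & V `<=` U]
}.

#[short(type="locallySolidType")]
HB.structure Definition LocallySolid (R : numDomainType) :=
  {E of TopologicalLmodule_isLocallySolid R E
      & VectorLattice R E & TopologicalLmodule R E}.

(* [tvsType] is locally convex, but the uniformity it carries need not be the
   one induced by the group structure; nothing below refers to it. *)
#[short(type="locallyConvexSolidType")]
HB.structure Definition LocallyConvexSolid (R : numDomainType) :=
  {E of LocallySolid R E & Tvs R E}.

Definition sigma_Lebesgue (R : numDomainType) (X : locallySolidType R) : Prop :=
  forall x : nat -> X, (forall n, poscone X (x n)) ->
    nonincreasing_seq x -> infimums (range x) 0 ->
    x @ \oo --> (0 : X).

(* Cauchy filters for the linear (translation-invariant) uniformity; the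
   library's [cauchy] would use an unrelated [Uniform] structure. *)
Definition linear_cauchy (R : numDomainType) (E : topologicalLmodType R)
    (F : set_system E) : Prop :=
  forall U : set E, nbhs (0 : E) U ->
    exists2 A : set E, F A & forall x y, A x -> A y -> U (x - y).

(* Equivalent to the convergence of every Cauchy net. *)
Definition linear_complete (R : numDomainType) (E : topologicalLmodType R)
    : Prop :=
  forall F : set_system E, ProperFilter F -> linear_cauchy F ->
    exists l : E, F --> l.

Definition topological_embedding (S T : topologicalType) (f : S -> T) : Prop :=
  injective f /\
  forall A : set S, open A <-> exists2 B : set T, open B & f @^-1` B = A.

Definition is_completion (R : numDomainType) (X Y : locallySolidType R)
    (J : {linear X -> Y}) : Prop :=
  [/\ hausdorff_space Y,
      linear_complete Y,
      topological_embedding J,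
      dense (range J) &
      poscone Y = closure (J @` poscone X)].

(* Main.v *)
Require Import Defs.
From HB Require Import structures.
From mathcomp Require Import all_boot all_order all_algebra.
From mathcomp Require Import all_classical all_reals all_analysis.
From mathcomp Require Import ring lra.

Set Implicit Arguments.
Unset Strict Implicit.
Unset Printing Implicit Defensive.

Import Order.TTheory GRing.Theory Num.Theory.
Import numFieldNormedType.Exports.

Local Open Scope classical_set_scope.
Local Open Scope ring_scope.

(** Completeness is tested by nets but the sigma-Lebesgue property by
sequences, so the two can be separated by a topology that is not metrizable:
an uncountable family of coordinates can enforce a condition on sequences that
disappears in the closure.

Let Y be the space c of convergent real sequences (with the sup norm) times the
product of uncountably many copies of the real line. An element of Y is a
function f on the set of sites Seq n, Lim, Iso c, with f (Seq n) tending to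
f Lim, and the topology of Y is that of uniform convergence on the sets that
contain finitely many sites Iso c. It is complete since a uniform limit of
convergent sequences is a convergent sequence ([converging_closed],
[elt_complete]). It is not sigma-Lebesgue: the indicator functions of
{Seq k | k >= n} together with Lim decrease to 0 because Lim is the limit of
the sites Seq k, yet they are all 1 at Lim.

Let X be the sublattice of those f for which f (Iso c) = f Lim for all but
finitely many c. A set in the bornology sees finitely many c only, so every
element of Y agrees with an element of X on it ([flat_agree]); hence X is dense
in Y and Y is the completion of X. Suppose now that x_n decreases to 0 in X.
The spikes at Seq k and at Iso c are in X, which forces x_n to tend to 0 at
these sites. Only countably many c violate x_n (Iso c) = x_n Lim for some n. There are
uncountably many c, so some c satisfies it for all n, and x_n Lim tends to 0 as
well. As in
Dini's theorem the convergence is then uniform on the sites Seq k and Lim, and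
the finitely many remaining sites are harmless ([flat_cvg0]).

Both X and Y are instances of one construction: a lattice of functions on a set
with the topology of uniform convergence on a bornology. *)

(** * Lattices of functions bounded on a bornology *)

Record bornology (S : Type) := Bornology {
  bornology_mem :> set S -> Prop ;
  bounded0 : bornology_mem set0 ;
  boundedU : forall A B,
    bornology_mem A -> bornology_mem B -> bornology_mem (A `|` B) ;
  bounded1 : forall s, bornology_mem [set s]
}.

(** Boundedness on the sets of the bornology is what makes scalar
multiplication continuous for uniform convergence on them. *)
Record function_lattice (R : realType) (S : Type) (B : bornology S) :=
  FunctionLattice {
  lattice_mem :> (S -> R) -> Prop ;
  lattice_zero : lattice_mem (fun=> 0) ;
  lattice_linear : forall (a : R) f g, lattice_mem f -> lattice_mem g ->
    lattice_mem (fun s => a * f s + g s) ;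
  lattice_max : forall f g, lattice_mem f -> lattice_mem g ->
    lattice_mem (fun s => Num.max (f s) (g s)) ;
  lattice_bounded : forall f A, lattice_mem f -> B A ->
    exists M, forall s, A s -> `|f s| <= M
}.

Record elt (R : realType) (S : Type) (B : bornology S)
    (V : function_lattice R B) := Elt {
  elt_fun :> S -> R ;
  elt_mem : V elt_fun
}.

Section FunctionLatticeStructure.
Variables (R : realType) (S : Type) (B : bornology S).
Variable V : function_lattice R B.
Implicit Types f g h : elt V.

Lemma elt_ext f g : f =1 g -> f = g.
Proof.
case: f g => [f Vf] [g Vg] /= /funext fg.
by subst g; congr Elt; exact: Prop_irrelevance.
Qed.

HB.instance Definition _ := gen_eqMixin (elt V).
HB.instance Definition _ := gen_choiceMixin (elt V).

Lemma lattice_ext (f g : S -> R) : V f -> f =1 g -> V g.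
Proof. by move=> + /funext fg; rewrite fg. Qed.

Lemma lattice_add f g : V (fun s => f s + g s).
Proof.
apply: (lattice_ext (lattice_linear 1 (elt_mem f) (elt_mem g))) => s.
by rewrite mul1r.
Qed.

Lemma lattice_scale (a : R) f : V (fun s => a * f s).
Proof.
apply: (lattice_ext (lattice_linear a (elt_mem f) (lattice_zero V))) => s.
by rewrite addr0.
Qed.

Lemma lattice_opp f : V (fun s => - f s).
Proof. by apply: (lattice_ext (lattice_scale (-1) f)) => s; rewrite mulN1r. Qed.

Lemma lattice_min f g : V (fun s => Num.min (f s) (g s)).
Proof.
apply: (lattice_ext (lattice_opp (Elt (lattice_max (lattice_opp f)
  (lattice_opp g))))) => s /=.
by rewrite oppr_max !opprK.
Qed.

Let zero := Elt (lattice_zero V).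
Let add f g := Elt (lattice_add f g).
Let opp f := Elt (lattice_opp f).
Let scale (a : R) f := Elt (lattice_scale a f).

Let addA : associative add.
Proof. by move=> f g h; apply: elt_ext => s /=; rewrite addrA. Qed.
Let addC : commutative add.
Proof. by move=> f g; apply: elt_ext => s /=; rewrite addrC. Qed.
Let add0 : left_id zero add.
Proof. by move=> f; apply: elt_ext => s /=; rewrite add0r. Qed.
Let addN : left_inverse zero opp add.
Proof. by move=> f; apply: elt_ext => s /=; rewrite addNr. Qed.

HB.instance Definition _ := GRing.isZmodule.Build (elt V) addA addC add0 addN.

Let scaleA (a b : R) f : scale a (scale b f) = scale (a * b) f.
Proof. by apply: elt_ext => s /=; rewrite mulrA. Qed.
Let scale1 : left_id 1 scale.
Proof. by move=> f; apply: elt_ext => s /=; rewrite mul1r. Qed.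
Let scaleDr : right_distributive scale +%R.
Proof. by move=> a f g; apply: elt_ext => s /=; rewrite mulrDr. Qed.
Let scaleDl f : {morph scale^~ f : a b / a + b}.
Proof. by move=> a b; apply: elt_ext => s /=; rewrite mulrDl. Qed.

HB.instance Definition _ :=
  GRing.Zmodule_isLmodule.Build R (elt V) scaleA scale1 scaleDr scaleDl.

Lemma elt0 s : (0 : elt V) s = 0. Proof. by []. Qed.
Lemma eltD f g s : (f + g) s = f s + g s. Proof. by []. Qed.
Lemma eltZ (a : R) f s : (a *: f) s = a * f s. Proof. by []. Qed.

Let le f g := `[< forall s, f s <= g s >].

Let elt_le_refl : reflexive le.
Proof. by move=> f; apply/asboolP. Qed.
Let elt_le_anti : antisymmetric le.
Proof.
move=> f g /andP[/asboolP fg /asboolP gf]; apply: elt_ext => s.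
by apply/le_anti; rewrite fg gf.
Qed.
Let elt_le_trans : transitive le.
Proof.
move=> g f h /asboolP fg /asboolP gh; apply/asboolP => s.
exact: le_trans (fg s) (gh s).
Qed.

HB.instance Definition _ :=
  Order.Le_isPOrder.Build ring_display (elt V)
    elt_le_refl elt_le_anti elt_le_trans.

Lemma elt_leP f g : reflect (forall s, f s <= g s) (f <= g).
Proof. exact: asboolP. Qed.

Let leD2r f g h : g <= h -> g + f <= h + f.
Proof. by move=> /elt_leP gh; apply/elt_leP => s; rewrite !eltD lerD2r. Qed.
Let leZ2l (a : R) f g : 0 <= a -> f <= g -> a *: f <= a *: g.
Proof.
by move=> a0 /elt_leP fg; apply/elt_leP => s; rewrite !eltZ ler_wpM2l.
Qed.
Let join f g := Elt (lattice_max (elt_mem f) (elt_mem g)).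
Let meet f g := Elt (lattice_min f g).
Let joinP f g h : (join f g <= h) = (f <= h) && (g <= h).
Proof.
apply/elt_leP/andP => [fgh|[/elt_leP fh /elt_leP gh] s /=].
  by split; apply/elt_leP => s; have := fgh s; rewrite /= ge_max => /andP[].
by rewrite ge_max fh gh.
Qed.
Let meetP f g h : (h <= meet f g) = (h <= f) && (h <= g).
Proof.
apply/elt_leP/andP => [hfg|[/elt_leP hf /elt_leP hg] s /=].
  by split; apply/elt_leP => s; have := hfg s; rewrite /= le_min => /andP[].
by rewrite le_min hf hg.
Qed.

HB.instance Definition _ := @POrderedLmodule_isVectorLattice.Build R (elt V)
  leD2r leZ2l join meet joinP meetP.

Lemma elt_vabs f s : vabs f s = `|f s|.
Proof. by rewrite /vabs /vjoin /= maxrN. Qed.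

Definition near_on (A : set S) (e : R) f g :=
  forall s, A s -> `|f s - g s| <= e.

(* The uniformity of uniform convergence on the sets of the bornology. *)
Let ent : set_system (elt V * elt V) := [set U | exists A e,
  [/\ B A, 0 < e & forall f g, near_on A e f g -> U (f, g)]].

Let ent_filter : Filter ent.
Proof.
split; first by exists set0, 1; split=> //; exact: bounded0.
  move=> U W [A [e [BA e0 AU]]] [A' [e' [BA' e'0 AW]]].
  exists (A `|` A'), (Num.min e e'); split; first exact: boundedU.
    by rewrite lt_min e0.
  move=> f g fg; split; [apply: AU|apply: AW] => s As.
    by have := fg s (or_introl As); rewrite le_min => /andP[].
  by have := fg s (or_intror As); rewrite le_min => /andP[].
move=> U W UW [A [e [BA e0 AU]]]; exists A, e; split=> // f g fg.
exact/UW/AU.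
Qed.

Let ent_diag U : ent U -> diagonal `<=` U.
Proof.
move=> [A [e [BA e0 AU]]] [f g] fg; apply: AU => s As.
by rewrite (fg : f = g) subrr normr0 ltW.
Qed.

Let ent_inv U : ent U -> ent (U^-1)%relation.
Proof.
move=> [A [e [BA e0 AU]]]; exists A, e; split=> // f g fg; apply: AU => s As.
by rewrite distrC fg.
Qed.

Let ent_split U : ent U ->
  exists2 W, ent W & (W \; W)%relation `<=` U.
Proof.
move=> [A [e [BA e0 AU]]].
exists [set fg | near_on A (e / 2) fg.1 fg.2].
  by exists A, (e / 2); split=> //; rewrite divr_gt0.
move=> [f h] [g /= fg gh]; apply: AU => s As.
by rewrite (splitr e) (le_trans (ler_distD (g s) _ _))// lerD ?fg ?gh.
Qed.

HB.instance Definition _ :=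
  isUniform.Build (elt V) ent_filter ent_diag ent_inv ent_split.

Lemma elt_nbhsP f (U : set (elt V)) : nbhs f U <->
  exists A e, [/\ B A, 0 < e & forall g, near_on A e f g -> U g].
Proof.
split=> [|[A [e [BA e0 AU]]]].
  move=> [W [A [e [BA e0 AW]]] WU]; exists A, e; split=> // g fg.
  by apply/WU/xsectionP/AW.
exists [set fg | near_on A e fg.1 fg.2].
  by exists A, e.
by move=> g /xsectionP /= fg; exact: AU.
Qed.

Lemma nbhs_near_on f (A : set S) (e : R) :
  B A -> 0 < e -> nbhs f (near_on A e f).
Proof. by move=> BA e0; apply/elt_nbhsP; exists A, e. Qed.

Let add_cont : continuous (fun fg : elt V * elt V => fg.1 + fg.2).
Proof.
move=> [f g] U /elt_nbhsP[A [e [BA e0 AU]]].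
exists (near_on A (e / 2) f, near_on A (e / 2) g) => /=.
  by split; apply: nbhs_near_on => //; rewrite divr_gt0.
move=> [f' g'] [/= ff' gg']; apply: AU => s As /=.
rewrite opprD addrACA (splitr e).
by rewrite (le_trans (ler_normD _ _))// lerD ?ff' ?gg'.
Qed.

HB.instance Definition _ :=
  PreTopologicalNmodule_isTopologicalNmodule.Build (elt V) add_cont.

Let scale_cont : continuous (fun af : R^o * elt V => af.1 *: af.2).
Proof.
move=> [a f] U /elt_nbhsP[A [e [BA e0 AU]]].
have [M fM] := lattice_bounded (elt_mem f) BA.
(* |a f - b g| <= |a - b| |f| + |b| |f - g| <= d |M| + (|a| + 1) d <= e. *)
pose d := e / (`|a| + `|M| + e + 1).
have D0 : 0 < `|a| + `|M| + e + 1.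
  by have := normr_ge0 a; have := normr_ge0 M; lra.
have d0 : 0 < d by rewrite divr_gt0.
have d1 : d <= 1.
  by rewrite ler_pdivrMr// mul1r; have := normr_ge0 a; have := normr_ge0 M; lra.
exists (ball a d, near_on A d f) => /=.
  by split; [exact: nbhsx_ballx|exact: nbhs_near_on].
move=> [b g] [/= ab fg]; apply: AU => s As /=.
have -> : a * f s - b * g s = (a - b) * f s + b * (f s - g s) by ring.
have {}ab : `|a - b| <= d by apply: ltW.
have bn : `|b| <= `|a| + 1.
  by have := ler_normB a (a - b); rewrite subKr; lra.
have fs : `|f s| <= `|M| by rewrite (le_trans (fM _ As))// ler_norm.
rewrite (le_trans (ler_normD _ _))// !normrM.
have E : e = d * `|M| + (`|a| + 1) * d + d * e.
  by rewrite /d; field; lra.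
rewrite {}[leRHS]E -[leLHS]addr0 lerD//; last by rewrite ltW// mulr_gt0.
by rewrite lerD// ler_pM// fg.
Qed.

HB.instance Definition _ :=
  TopologicalNmodule_isTopologicalLmodule.Build R (elt V) scale_cont.

(** The sets [near_on A e f] need not be open; asking for a radius smaller than
[e] gives open sets, which are the convex basis of the topology. *)
Lemma open_near_on f (A : set S) (e : R) : B A ->
  open [set g | exists2 d, d < e & near_on A d f g].
Proof.
move=> BA; rewrite openE => g [d de fg]; apply/elt_nbhsP.
exists A, ((e - d) / 2); split=> //; first by rewrite divr_gt0// subr_gt0.
move=> h gh; exists (d + (e - d) / 2); first lra.
by move=> s As; rewrite (le_trans (ler_distD (g s) _ _))// lerD ?fg ?gh.
Qed.

Let locally_convex_elt : exists2 Bs : set_system (elt V),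
  (forall b, b \in Bs -> convex_set b) & basis Bs.
Proof.
exists [set U | exists f A e,
    B A /\ U = [set g | exists2 d, d < e & near_on A d f g]].
  move=> U /set_mem [f [A [e [BA ->]]]] g h t.
  move=> /set_mem[d de fg] /set_mem[d' d'e fh].
  apply/mem_set; exists (Num.max d d'); first by rewrite gt_max de.
  move=> s As.
  have t0 : 0 <= t%:num by [].
  have t1 : t%:num <= 1 by [].
  rewrite [X in `|X|](_ : _ =
    t%:num * (f s - g s) + (1 - t%:num) * (f s - h s)); last first.
    by rewrite /= /unstable.onem; ring.
  have -> : Num.max d d' = t%:num * Num.max d d' + (1 - t%:num) * Num.max d d'.
    by ring.
  rewrite (le_trans (ler_normD _ _))// !normrM (ger0_norm t0).
  rewrite (@ger0_norm _ (1 - _)) ?subr_ge0//.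
  rewrite lerD// ler_wpM2l ?subr_ge0// le_max.
    by rewrite fg.
  by rewrite fh// orbT.
split=> [U [f [A [e [BA ->]]]]|f U fU]; first exact: open_near_on.
have /elt_nbhsP[A [e [BA e0 AU]]] : nbhs f U := fU.
exists [set g | exists2 d, d < e & near_on A d f g].
  split; first by exists f, A, e.
  by exists 0 => // s As; rewrite subrr normr0.
by move=> g [d de fg]; apply: AU => s As; rewrite (le_trans (fg s As))// ltW.
Qed.

HB.instance Definition _ := Uniform_isTvs.Build R (elt V) locally_convex_elt.

Let locally_solid_elt (U : set (elt V)) : nbhs (0 : elt V) U ->
  exists W : set (elt V), [/\ nbhs (0 : elt V) W, solid W & W `<=` U].
Proof.
move=> /elt_nbhsP[A [e [BA e0 AU]]].
exists (near_on A e 0); split; [exact: nbhs_near_on| |exact: AU].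
move=> f g /elt_leP fg g0 s As.
have := fg s; have := g0 s As; rewrite !elt_vabs elt0 !sub0r !normrN.
by move=> ge fg'; exact: le_trans fg' ge.
Qed.

HB.instance Definition _ :=
  TopologicalLmodule_isLocallySolid.Build R (elt V) locally_solid_elt.

End FunctionLatticeStructure.

(** * Separation and completeness *)

Section UniformConvergence.
Variables (R : realType) (S : Type) (B : bornology S).
Variable V : function_lattice R B.
Implicit Types f g h : elt V.

(** Singletons are in the bornology, so distinct functions are separated by their
values at a site where they differ. *)
Lemma elt_hausdorff : hausdorff_space (elt V).
Proof.
move=> f g fg; apply: elt_ext => s; apply/eqP; rewrite -subr_eq0 -normr_eq0.
rewrite eq_le normr_ge0 andbT; apply/ler_addgt0Pl => e e0; rewrite addr0.
have e2 : 0 < e / 2 by rewrite divr_gt0.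
have [h [fh gh]] := fg _ _ (nbhs_near_on f (bounded1 B s) e2)
  (nbhs_near_on g (bounded1 B s) e2).
rewrite (splitr e) (le_trans (ler_distD (h s) _ _))// lerD//; first exact: fh.
by rewrite distrC; exact: gh.
Qed.

Lemma closed_poscone : closed (poscone (elt V)).
Proof.
move=> f fP; apply/elt_leP => s; apply/ler_addgt0Pl => e e0.
have [g [/elt_leP g0]] := fP _ (nbhs_near_on f (bounded1 B s) e0).
by move=> /(_ s erefl); have := g0 s; rewrite !elt0 ler_norml; lra.
Qed.

(** A Cauchy filter converges pointwise in the real line, and the Cauchy
condition makes the convergence uniform on each set of the bornology. So it is
enough that [V] contains the functions that it approximates uniformly on these
sets. *)
Lemma elt_complete :
  (forall h : S -> R, (forall A (e : R), B A -> 0 < e ->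
     exists f : elt V, forall s, A s -> `|h s - f s| <= e) -> V h) ->
  linear_complete (elt V).
Proof.
move=> Vclosed F FF Fcauchy.
have F_near A (e : R) : B A -> 0 < e -> exists2 P : set (elt V), F P &
    forall f g, P f -> P g -> near_on A e f g.
  move=> BA e0; have [P FP PP] := Fcauchy _ (nbhs_near_on 0 BA e0).
  exists P => // f g Pf Pg s As; have := PP f g Pf Pg s As.
  by rewrite elt0 sub0r normrN.
have lim_s s : exists l : R, (fun f : elt V => f s) @ F --> l.
  apply/cvg_ex/cauchy_cvgP/cauchy_ballP => e e0.
  have e2 : 0 < e / 2 by rewrite divr_gt0.
  have [P FP PP] := F_near _ _ (bounded1 B s) e2.
  exists (fun r => P `&` (fun f => f s = r) !=set0,
          fun r => P `&` (fun f => f s = r) !=set0) => /=.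
    by split; rewrite /nbhs /=; apply: filterS FP => f Pf; exists f.
  move=> [r r'] /= [[f [Pf <-]] [g [Pg <-]]].
  by apply: le_lt_trans (PP f g Pf Pg s erefl) _; lra.
pose h s := projT1 (cid (lim_s s)).
have h_lim s : (fun f : elt V => f s) @ F --> h s := projT2 (cid (lim_s s)).
have h_near A (e : R) : B A -> 0 < e ->
    F [set f : elt V | forall s, A s -> `|h s - f s| <= e].
  move=> BA e0; have [P FP PP] := F_near A e BA e0.
  apply: filterS (FP) => f Pf s As; apply/ler_addgt0Pl => d d0.
  have /filter_ex[g [Pg gd]] : F (P `&` [set g : elt V | `|h s - g s| < d]).
    apply: filterI FP _.
    by move/cvgrPdist_lt : (h_lim s) => /(_ _ d0).
  rewrite (le_trans (ler_distD (g s) _ _))// lerD//; first exact: ltW.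
  exact: (PP g f Pg Pf).
have Vh : V h.
  apply: Vclosed => A e BA e0; exact: filter_ex (h_near A e BA e0).
exists (Elt Vh) => U /elt_nbhsP[A [e [BA e0 AU]]].
apply: filterS (h_near A e BA e0) => f hf; exact: AU.
Qed.

End UniformConvergence.

(** * Inclusion of a sublattice *)

Section Inclusion.
Variables (R : realType) (S : Type) (B : bornology S).
Variables V W : function_lattice R B.
Hypothesis VW : forall f, V f -> W f.

Definition elt_incl (f : elt V) : elt W := Elt (VW (elt_mem f)).

Let incl_is_linear : linear elt_incl.
Proof. by move=> a f g; exact: elt_ext. Qed.

HB.instance Definition _ :=
  GRing.isLinear.Build R (elt V) (elt W) _ elt_incl incl_is_linear.

(** The topologies of [V] and [W] are defined by the same differences, so that of
[V] is induced by that of [W]. *)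
Lemma elt_incl_embedding : topological_embedding elt_incl.
Proof.
split=> [f g fg|U].
  by apply: elt_ext => s; rewrite -[f s]/(elt_incl f s) fg.
split=> [Uopen|[P Popen <-]]; last first.
  rewrite openE => f Pf.
  have /elt_nbhsP[A [e [BA e0 AP]]] : nbhs (elt_incl f) P.
    exact: open_nbhs_nbhs.
  by apply/elt_nbhsP; exists A, e; split=> // g fg; exact: AP.
(* The largest open set of the big lattice whose trace is contained in U. *)
exists [set y | forall f, elt_incl f = y -> U f]°; first exact: open_interior.
apply/seteqP; split=> [f /interior_subset|f Uf]; first exact.
have /elt_nbhsP[A [e [BA e0 AU]]] : nbhs f U by exact: open_nbhs_nbhs.
apply/elt_nbhsP; exists A, e; split=> // y fy g gy; apply: AU => s As.
by rewrite -[g s]/(elt_incl g s) gy; exact: fy.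
Qed.

(* This is stronger than density: elements of the big lattice are matched exactly,
not just approximated, on each set of the bornology. *)
Hypothesis agree : forall g A, W g -> B A ->
  exists2 f, V f & forall s, A s -> f s = g s.

Lemma elt_incl_dense : dense (range elt_incl).
Proof.
move=> U [g Ug] Uopen.
have /elt_nbhsP[A [e [BA e0 AU]]] : nbhs g U by exact: open_nbhs_nbhs.
have [f Vf fg] := agree (elt_mem g) BA.
exists (elt_incl (Elt Vf)); split; last by exists (Elt Vf).
by apply: AU => s As /=; rewrite fg// subrr normr0 ltW.
Qed.

(** The positive part of a function of [V] that agrees with [g >= 0] on [A] is
positive and still agrees with [g] on [A]. *)
Lemma poscone_incl : poscone (elt W) = closure (elt_incl @` poscone (elt V)).
Proof.
apply/seteqP; split=> [g /elt_leP g0 U|]; last first.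
  rewrite [X in _ `<=` X](iffLR (closure_id _) (closed_poscone (V := W))).
  apply: closureS => _ [f /elt_leP f0 <-]; exact/elt_leP.
move=> /elt_nbhsP[A [e [BA e0 AU]]].
have [f Vf fg] := agree (elt_mem g) BA.
pose f' := Elt (lattice_max Vf (lattice_zero V)).
exists (elt_incl f'); split.
  by exists f' => //; apply/elt_leP => s; rewrite /= le_max lexx orbT.
apply: AU => s As /=.
by rewrite fg// (max_idPl (g0 s)) subrr normr0 ltW.
Qed.

End Inclusion.

(** * The sites *)

(** The convergent sequence [Seq n] with its limit point [Lim], and uncountably
many further sites, indexed by the sets of natural numbers. *)
Inductive site := Seq of nat | Lim | Iso of set nat.

(** Cantor's diagonal argument, against an injection of the sets into the
natural numbers. *)
Lemma uncountable_sets_of_nat : ~ countable [set: set nat].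
Proof.
move=> /countable_injP[f f_inj].
pose D := [set n | exists2 A, f A = n & ~ A n].
have DfD : ~ D (f D) by move=> DfD; case: (DfD) => A /f_inj -> //; rewrite inE.
by apply: (DfD); exists D.
Qed.

(** Uniform convergence on small sets is uniform convergence on all the sites
[Seq n] and [Lim], and pointwise convergence on the sites [Iso c]. *)
Definition small (A : set site) := finite_set (Iso @^-1` A).

Lemma small0 : small set0.
Proof. exact: finite_set0. Qed.

Lemma smallU A A' : small A -> small A' -> small (A `|` A').
Proof. by move=> sA sA'; rewrite /small preimage_setU finite_setU. Qed.

Lemma small1 s : small [set s].
Proof.
case: s => [n||c]; try by rewrite /small (_ : _ @^-1` _ = set0) //;
  apply/seteqP; split.
rewrite /small (_ : _ @^-1` _ = [set c]); first exact: finite_set1.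
by apply/seteqP; split=> d /= => [[]|->].
Qed.

Definition site_bornology := Bornology small0 smallU small1.

(** * The two lattices of functions *)

Section Example.
Variable R : realType.
Implicit Types f g : site -> R.

Definition converging f := (fun n => f (Seq n)) @ \oo --> f Lim.

Definition eventually_flat f :=
  finite_set [set c | f (Iso c) != f Lim].

Lemma converging0 : converging (fun=> 0).
Proof. exact: cvg_cst. Qed.

Lemma converging_linear (a : R) f g : converging f -> converging g ->
  converging (fun s => a * f s + g s).
Proof. by move=> fl gl; apply: cvgD gl; exact: cvgMl_tmp. Qed.

Lemma converging_max f g : converging f -> converging g ->
  converging (fun s => Num.max (f s) (g s)).
Proof.
move=> fl gl; rewrite /converging maxr_absE.
under eq_fun do rewrite maxr_absE.
by apply: cvgMr_tmp; apply: cvgD; [exact: cvgD|apply: cvg_norm; exact: cvgB].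
Qed.

Lemma finite_iso_bounded f (D : set (set nat)) : finite_set D ->
  exists M, forall c, D c -> `|f (Iso c)| <= M.
Proof.
move=> /finite_seqP[r ->]; elim: r => [|c r [M rM]]; first by exists 0.
exists (Num.max `|f (Iso c)| M) => d; rewrite /= inE le_max.
by move=> /orP[/eqP->|/rM ->]; rewrite ?lexx ?orbT.
Qed.

Lemma converging_bounded f A : converging f -> site_bornology A ->
  exists M, forall s, A s -> `|f s| <= M.
Proof.
move=> fl /(finite_iso_bounded f)[M AM].
have : cvg ((fun n => f (Seq n)) @ \oo) by apply/cvg_ex; exists (f Lim).
move=> /cvg_seq_bounded/pinfty_ex_gt0[M' M'0 fM'].
exists (Num.max M (Num.max M' `|f Lim|)) => -[n||c] As; rewrite !le_max.
- by rewrite (fM' n)// orbT.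
- by rewrite lexx !orbT.
- by rewrite AM.
Qed.

Definition convergent_functions :=
  FunctionLattice converging0 converging_linear converging_max
    converging_bounded.

Lemma flat0 : eventually_flat (fun=> 0).
Proof.
rewrite /eventually_flat (_ : [set _ | _] = set0); first exact: finite_set0.
by apply/seteqP; split=> c //=; rewrite eqxx.
Qed.

Lemma flat_op2 (op : R -> R -> R) f g : eventually_flat f ->
  eventually_flat g -> eventually_flat (fun s => op (f s) (g s)).
Proof.
move=> ff fg.
apply: (sub_finite_set _ (_ : finite_set ([set c | f (Iso c) != f Lim] `|`
  [set c | g (Iso c) != g Lim]))); last by rewrite finite_setU.
move=> c /=; apply: contraPP => /not_orP[/negP/negPn/eqP-> /negP/negPn/eqP->].
by rewrite eqxx.
Qed.

Definition converging_flat f := converging f /\ eventually_flat f.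

Lemma flat_linear (a : R) f g : converging_flat f -> converging_flat g ->
  converging_flat (fun s => a * f s + g s).
Proof.
move=> [fl ff] [gl gf]; split; first exact: converging_linear.
exact: (flat_op2 (fun x y => a * x + y)).
Qed.

Lemma flat_max f g : converging_flat f -> converging_flat g ->
  converging_flat (fun s => Num.max (f s) (g s)).
Proof.
move=> [fl ff] [gl gf]; split; first exact: converging_max.
exact: (flat_op2 Num.max).
Qed.

Definition flat_functions :=
  FunctionLattice (conj converging0 flat0) flat_linear flat_max
    (fun f A fX => converging_bounded (fX.1)).

Local Notation X := (elt flat_functions).
Local Notation Y := (elt convergent_functions).

Lemma flat_convergent f : flat_functions f -> convergent_functions f.
Proof. by case. Qed.

(** The sites [Seq n] and [Lim] form one small set, so approximation on small sets
is uniform there and preserves convergence along the sequence. *)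
Lemma converging_closed f :
  (forall A (e : R), site_bornology A -> 0 < e ->
    exists g : Y, forall s, A s -> `|f s - g s| <= e) ->
  convergent_functions f.
Proof.
move=> fY; apply/cvgrPdist_le => e e0.
have sA : site_bornology (range Seq `|` [set Lim]).
  apply: smallU (small1 Lim); rewrite /small (_ : _ @^-1` _ = set0) //.
  by apply/seteqP; split=> c // -[].
have [|g fg] := fY _ (e / 3) sA; first by rewrite divr_gt0.
have /cvgrPdist_le/(_ (e / 3)) := elt_mem g.
move=> /(_ (divr_gt0 e0 _)) gl; near=> n.
have : `|g Lim - g (Seq n)| <= e / 3 by near: n; apply: gl.
have := fg Lim (or_intror erefl).
have := fg (Seq n) (or_introl (ex_intro2 _ _ n I erefl)).
rewrite !ler_norml; lra.
Unshelve. all: by end_near. Qed.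

(** Only finitely many sites [Iso c] are in a small set: the values of [g] can be
reset to [g Lim] at all the others. *)
Lemma flat_agree g A : convergent_functions g -> site_bornology A ->
  exists2 f, flat_functions f & forall s, A s -> f s = g s.
Proof.
move=> gl sA.
exists (fun s => if s is Iso c then if `[< A s >] then g s else g Lim else g s).
  split=> //; apply: sub_finite_set sA => c /=.
  by case: asboolP => //; rewrite eqxx.
by move=> [n||c] //= Ac; rewrite asboolT.
Qed.

(** * The sublattice is sigma-Lebesgue *)

(** [Lim] is excluded because it is not isolated: a function that vanishes on all
the sites [Seq n] vanishes at [Lim]. *)
Lemma spike_flat (s : site) (a : R) : s <> Lim ->
  flat_functions (fun t => if `[< t = s >] then a else 0).
Proof.
move=> sLim; split; rewrite /converging /eventually_flat (asboolF (nesym sLim)).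
  apply: cvg_near_cst; case: s {sLim} => [n||c]; last 2 first.
  - by near=> m; rewrite asboolF.
  - by near=> m; rewrite asboolF.
  exists n.+1 => // m /= nm; rewrite asboolF// => -[mn].
  by rewrite mn ltnn in nm.
case: s {sLim} => [n||c].
- rewrite (_ : [set _ | _] = set0); first exact: finite_set0.
  by apply/seteqP; split=> d //=; rewrite asboolF// eqxx.
- rewrite (_ : [set _ | _] = set0); first exact: finite_set0.
  by apply/seteqP; split=> d //=; rewrite asboolF// eqxx.
- apply: sub_finite_set (finite_set1 c) => d /=.
  by case: asboolP => [[]|_] //; rewrite eqxx.
Unshelve. all: by end_near. Qed.

Section FlatSigmaLebesgue.
Variable x : nat -> X.
Hypothesis x_ge0 : forall n, poscone X (x n).
Hypothesis x_dec : nonincreasing_seq x.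
Hypothesis x_inf : infimums (range x) (0 : X).

Let x_ge0' n s : 0 <= x n s.
Proof. by have /elt_leP/(_ s) := x_ge0 n. Qed.

Let x_dec' m n s : (m <= n)%N -> x n s <= x m s.
Proof. by move=> mn; have /elt_leP/(_ s) := x_dec mn. Qed.

(* Otherwise the spike of height e at s would be a lower bound of the x_n. *)
Let small_at s (e : R) : 0 < e -> s <> Lim -> exists n, x n s < e.
Proof.
move=> e0 sLim; apply: contrapT => /forallNP xs.
have /x_inf.2/elt_leP/(_ s) : lbound (range x) (Elt (spike_flat e sLim)).
  move=> _ [n _ <-]; apply/elt_leP => t /=.
  by case: asboolP => [->|_]; [rewrite leNgt; apply/negP|].
by rewrite /= asboolT// leNgt e0.
Qed.

(* Some c avoids the countably many exceptions of all the x_n: at Iso c every x_n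
takes its value at Lim. *)
Let small_at_lim (e : R) : 0 < e -> exists n, x n Lim < e.
Proof.
move=> e0.
have : ~ (\bigcup_n [set c | x n (Iso c) != x n Lim] = setT).
  move=> cover; apply: uncountable_sets_of_nat; rewrite -cover.
  apply: bigcup_countable => // n _; apply: finite_set_countable.
  exact: (elt_mem (x n)).2.
rewrite -subTset => /nonsubset[c [_ cx]].
have [|n xc] := @small_at (Iso c) e e0; first by [].
exists n; suff <- : x n (Iso c) = x n Lim by [].
by apply: contrapT => /eqP xcL; apply: cx; exists n.
Qed.

Let near_small s (e : R) : 0 < e -> \forall n \near \oo, x n s < e.
Proof.
move=> e0.
have [n xn] : exists n, x n s < e.
  have [->|sLim] := pselect (s = Lim); first exact: small_at_lim.
  exact: small_at.
by exists n => // m /= nm; apply: le_lt_trans xn; exact: x_dec'.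
Qed.

(** Dini's argument: one [x N] that is small at [Lim] is small at [Seq k] for all
[k >= K], hence so are its successors; finitely many sites of [A] remain, and
pointwise convergence handles them. *)
Lemma flat_cvg0 : x @ \oo --> (0 : X).
Proof.
move=> U /elt_nbhsP[A [e [sA e0 AU]]].
have [N xN] : exists N, x N Lim < e / 2.
  by apply: small_at_lim; rewrite divr_gt0.
have [K _ xK] : \forall k \near \oo, x N (Seq k) < e.
  have /cvgrPdist_lt/(_ (e / 2)) := (elt_mem (x N)).1.
  move=> /(_ (divr_gt0 e0 _)) xl; near=> k.
  have : `|x N Lim - x N (Seq k)| < e / 2 by near: k; exact: xl.
  by rewrite ltr_norml; lra.
have near_seq k : \forall n \near \oo, forall j, (j < k)%N -> x n (Seq j) < e.
  elim: k => [|k IH]; first by near=> n.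
  near=> n => j; rewrite ltnS leq_eqVlt => /orP[/eqP->|].
    by near: n; exact: near_small.
  by move: j; near: n.
have near_iso : \forall n \near \oo, forall c, A (Iso c) -> x n (Iso c) < e.
  have [r Ar] := iffLR (finite_seqP _) sA.
  suff : \forall n \near \oo, forall c, c \in r -> x n (Iso c) < e.
    apply: filterS => n xn c Ac; apply: xn.
    by have : (Iso @^-1` A) c := Ac; rewrite Ar.
  elim: r {Ar} => [|d r IH]; first by near=> n.
  near=> n => c; rewrite inE => /orP[/eqP->|].
    by near: n; exact: near_small.
  by move: c; near: n.
suff : \forall n \near \oo, U (x n) by [].
near=> n; apply: AU => s As.
rewrite elt0 sub0r normrN ger0_norm ?x_ge0'// ltW//.
case: s As => [k||c] As.
- have [kK|Kk] := ltnP k K; first by move: k kK {As}; near: n; exact: near_seq.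
  by apply: le_lt_trans (xK k Kk); apply: x_dec'; near: n; exact: nbhs_infty_ge.
- by near: n; exact: near_small.
- by move: c As; near: n; exact: near_iso.
Unshelve. all: by end_near. Qed.

End FlatSigmaLebesgue.

(** * The big lattice is not sigma-Lebesgue *)

Definition tail_fun n (s : site) : R :=
  match s with Seq k => (n <= k)%N%:R | Lim => 1 | Iso _ => 0 end.

Lemma tail_converging n : converging (tail_fun n).
Proof.
by apply: cvg_near_cst; exists n => // k /= nk; rewrite nk.
Qed.

(** A lower bound of the tails is at most 0 at every [Seq k], hence also at the
limit [Lim], where the tails keep the value 1. *)
Lemma not_sigma_Lebesgue_convergent : ~ sigma_Lebesgue Y.
Proof.
pose y n : Y := Elt (@tail_converging n : convergent_functions _).
have y_ge0 n : poscone Y (y n).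
  by apply/elt_leP => -[k||c] /=; rewrite ?ler0n ?ler01.
have y_dec : nonincreasing_seq y.
  move=> m n mn; apply/elt_leP => -[k||c] //=; rewrite ler_nat.
  by case: (leqP n k) => // nk; rewrite (leq_trans mn nk).
have y_inf : infimums (range y) (0 : Y).
  split=> [_ [n _ <-]|z zy]; first exact: y_ge0.
  have zs s n : z s <= tail_fun n s.
    by have /elt_leP/(_ s) := zy _ (ex_intro2 _ _ n I erefl).
  have z_seq k : z (Seq k) <= 0 by have := zs (Seq k) k.+1; rewrite /= ltnn.
  apply/elt_leP => -[k||c]; [exact: z_seq| |exact: (zs (Iso c) 0%N)].
  have zl : (fun n => z (Seq n)) @ \oo --> z Lim := elt_mem z.
  rewrite -(cvg_lim _ zl)//; apply: limr_le.
    by apply/cvg_ex; exists (z Lim).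
  by near=> n; exact: z_seq.
have half_gt0 : 0 < 1 / 2 :> R by rewrite divr_gt0.
have sL : site_bornology [set Lim] := small1 Lim.
move=> /(_ y y_ge0 y_dec y_inf)/(_ _ (nbhs_near_on 0 sL half_gt0))[n _].
move=> /(_ n (leqnn n) Lim erefl).
by rewrite elt0 sub0r normrN /= normr1; lra.
Unshelve. all: by end_near. Qed.

End Example.

(** * The counterexample *)

Theorem theorem2p5 (R : realType) :
  exists X : locallyConvexSolidType R,
    [/\ hausdorff_space X,
        sigma_Lebesgue X &
        exists (Y : locallySolidType R) (J : {linear X -> Y}),
          is_completion J /\ ~ sigma_Lebesgue Y].
Proof.
exists (elt (flat_functions R)); split; first exact: elt_hausdorff.
  exact: flat_cvg0.
exists (elt (convergent_functions R)), (elt_incl (@flat_convergent R)).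
split; last exact: not_sigma_Lebesgue_convergent.
split.
- exact: elt_hausdorff.
- apply: elt_complete; exact: converging_closed.
- exact: elt_incl_embedding.
- exact: elt_incl_dense (@flat_agree R).
- exact: poscone_incl (@flat_agree R).
Qed.
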